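(* For every integer $d \ge 1$, the polynomial $F_d(x,y)$ equals the Euler--Mahonian polynomial $E_d(x,y)$, i.e. \[ F_d(x,y) \,=\, \sum_{\tau \in S_d} x^{\operatorname{des}(\tau)} y^{\operatorname{maj}(\tau)} . \]
   Context: For $d \ge 1$, define $F_d(q_0,w)$ recursively by $F_1(q_0,w) = 1$ and, for $d \ge 2$, \[ F_d(q_0,w) \,=\, \frac{(1 - q_0 w^d)\, F_{d-1}(q_0,w) \;-\; w(1-q_0)\, F_{d-1}(q_0 w, w)}{1-w} \] (these are polynomials in $\mathbb{Z}[q_0,w]$). For a permutation $\tau$ of $\{1,\dots,d\}$ (an element of the symmetric group $S_d$), let $\operatorname{Des}(\tau) := \{ j \in \{1,\dots,d-1\} : \tau(j) > \tau(j+1)\}$ be its descent set, $\operatorname{des}(\tau) := |\operatorname{Des}(\tau)|$, and $\operatorname{maj}(\tau) := \sum_{j \in \operatorname{Des}(\tau)} j$. The Euler--Mahonian polynomial is $E_d(x,y) := \sum_{\tau \in S_d} x^{\operatorname{des}(\tau)} y^{\operatorname{maj}(\tau)}$. *)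

(* Defs.v *)
From mathcomp Require Import all_boot all_order all_algebra all_fingroup.

Set Implicit Arguments.
Unset Strict Implicit.
Unset Printing Implicit Defensive.

Import GRing.Theory.
Local Open Scope ring_scope.

(* Z[q0, w] is represented as Z[q0][w].  With w as the outer variable, 1 - w   *)
(* has an invertible leading coefficient, so that %/ by 1 - w is a genuine     *)
(* Euclidean division.                                                         *)
Definition q0 : {poly {poly int}} := 'X%:P.
Definition w : {poly {poly int}} := 'X.

(* P(a, b): a is substituted for q0 and b for w. *)
Definition subst2 (P a b : {poly {poly int}}) : {poly {poly int}} :=
  (map_poly (fun c : {poly int} => (map_poly intr c).[a]) P).[b].

(* F 0 is a dummy value.  The division is exact: see F_rec below. *)
Fixpoint F (d : nat) : {poly {poly int}} :=
  match d with
  | 0 => 0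
  | d'.+1 =>
    if d' is 0 then 1 else
    ((1 - q0 * w ^+ d) * F d' - w * (1 - q0) * subst2 (F d') (q0 * w) w)
      %/ (1 - w)
  end.

(* 'S_d permutes {0, ..., d-1}, so tau(k) for k in {1, ..., d} is t at the    *)
(* ordinal k - 1.  Elements of Des t are the 1-based descent positions: j is   *)
(* in Des t when tau(j) > tau(j+1), i.e. when t (j - 1) > t j, with i = j - 1. *)
Definition Des (d : nat) (t : 'S_d) : {set 'I_d} :=
  [set j : 'I_d | [exists i : 'I_d, (i.+1 == j :> nat) && (t j < t i)%N]].

Definition des (d : nat) (t : 'S_d) : nat := #|Des t|.

Definition maj (d : nat) (t : 'S_d) : nat := (\sum_(j in Des t) j)%N.

Definition EulerMahonian (d : nat) : {poly {poly int}} :=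
  \sum_(t : 'S_d) q0 ^+ des t * w ^+ maj t.

Fact subst2_at1 (P : {poly {poly int}}) : (subst2 P (q0 * w) w).[1] = P.[1].
Proof.
have f1 (c : {poly int}) :
    (map_poly intr c).[q0 * w].[1] = c :> {poly int}.
  elim/poly_ind: c => [|c n IH]; first by rewrite rmorph0 !horner0.
  rewrite rmorphD rmorphM /= map_polyX map_polyC /= hornerD hornerMX hornerC.
  rewrite hornerD !hornerM IH /q0 /w hornerC hornerX mulr1; congr (_ + _).
  by rewrite -[LHS]/(horner_eval 1 _) rmorph_int -[in RHS](intz n) rmorph_int.
rewrite /subst2 /map_poly horner_poly horner_sum [RHS]horner_coef.
by apply: eq_bigr => i _; rewrite hornerM f1 hornerXn.
Qed.

Fact F_rec (d : nat) : (2 <= d)%N ->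
  (1 - w) * F d =
  (1 - q0 * w ^+ d) * F d.-1 - w * (1 - q0) * subst2 (F d.-1) (q0 * w) w.
Proof.
case: d => [|[|d]] // _.
have E (G : {poly {poly int}}) (n : nat) :
    let N := (1 - q0 * w ^+ n) * G - w * (1 - q0) * subst2 G (q0 * w) w in
    (1 - w) * (N %/ (1 - w)) = N.
  move=> N; have [p ->] : exists p, N = p * ('X - 1%:P).
    apply/factor_theorem/rootP; rewrite /N /q0 /w.
    rewrite !(hornerD, hornerN, hornerM, hornerC, hornerX, hornerXn).
    by rewrite subst2_at1 expr1n mulr1 mul1r subrr.
  have -> : p * ('X - 1%:P) = - p * (1 - w) by rewrite mulNr -mulrN opprB.
  rewrite Pdiv.IdomainUnit.mulpK 1?mulrC //.
  by rewrite -opprB lead_coefN lead_coefXsubC unitrN unitr1.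
exact: E (F d.+1) d.+2.
Qed.

Fact subst2_q0 (a b : {poly {poly int}}) : subst2 q0 a b = a.
Proof.
rewrite /subst2 /q0 [map_poly _ 'X%:P]/map_poly horner_poly size_polyC.
by rewrite polyX_eq0 big_ord1 coefC eqxx map_polyX hornerX expr0 mulr1.
Qed.

Fact subst2_w (a b : {poly {poly int}}) : subst2 w a b = b.
Proof.
rewrite /subst2 /w [map_poly _ 'X]/map_poly horner_poly size_polyX.
rewrite big_ord_recl big_ord1 !coefX.
have -> : (map_poly intr (0 : {poly int})).[a] = 0 by rewrite rmorph0 horner0.
have -> : (map_poly intr (1 : {poly int})).[a] = 1 by rewrite rmorph1 hornerE.
by rewrite mul0r add0r mul1r expr1.
Qed.

(* Main.v *)
(** Writing $n = d - 1$, insert the maximal letter $n$ (letters are 0-based) at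
    slot $p \le n$ of a permutation $s$ of $n$ letters with descent set $D$.
    Slots of $D$ and the last slot keep the number of descents, all others raise
    it by one.  Summed over $p$, the change of (des, maj) telescopes after
    multiplication by $1 - w$ and depends on $s$ only through des $s$; summing
    over $s$ gives the defining recurrence of $F$. *)
Require Import Defs.
From mathcomp Require Import all_boot all_order all_algebra all_fingroup.
From mathcomp Require Import zify ring.

Import GRing.Theory.
Local Open Scope ring_scope.

Section Descents.

Variable n : nat.
Implicit Types (s : 'S_n) (p : 'I_n.+1) (i : 'I_n).

Lemma mem_Des_succ {d} (t : 'S_d) (i j : 'I_d) :
  i.+1 = j :> nat -> (j \in Des t) = (t j < t i)%N.
Proof.
move=> ij; rewrite inE; apply/existsP/idP => [[k /andP[/eqP kj]]|ltji].
  by have /val_inj-> : k = i :> nat by lia.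
by exists i; rewrite ij eqxx.
Qed.

Lemma mem_Des0 {d} (t : 'S_d) (j : 'I_d) :
  j = 0%N :> nat -> (j \in Des t) = false.
Proof. by move=> j0; rewrite inE; apply/existsP => -[k]; rewrite j0. Qed.

Lemma val_lift_perm_max p s i :
  lift_perm p ord_max s (lift p i) = s i :> nat.
Proof. by rewrite lift_perm_lift lift_max. Qed.

Lemma mem_Des_slot p s : p \in Des (lift_perm p ord_max s) = false.
Proof.
case: (posnP p) => [p0|p_gt0]; first exact: mem_Des0.
have lt_p : (p.-1 < n.+1)%N by have := ltn_ord p; lia.
rewrite (@mem_Des_succ _ _ (Ordinal lt_p)) /=; last by lia.
by rewrite lift_perm_id ltnNge -ltnS ltn_ord.
Qed.

(** Consecutive letters of [s] stay consecutive unless the new letter separates them. The letter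
    just after the new one, at [lift p i] with [i = p], always ends a descent. *)
Lemma mem_Des_lift p s i :
  (lift p i \in Des (lift_perm p ord_max s)) = (i \in Des s) || (i == p :> nat).
Proof.
case: (eqVneq (i : nat) p) => [ip|nip].
  rewrite orbT (@mem_Des_succ _ _ p) /=; last by rewrite /bump; lia.
  by rewrite val_lift_perm_max lift_perm_id /= ltn_ord.
rewrite orbF; case: (posnP i) => [i0|i_gt0].
  by rewrite !mem_Des0 //= /bump; lia.
have lt_i : (i.-1 < n)%N by have := ltn_ord i; lia.
rewrite (@mem_Des_succ _ _ (Ordinal lt_i)) /=; last by lia.
rewrite (@mem_Des_succ _ _ (lift p (Ordinal lt_i))); last by rewrite /= /bump; lia.
by rewrite !val_lift_perm_max.
Qed.

(** The slot is recovered as the position of the maximal letter, the other letters then give [s],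
    and both sides have [(n + 1)!] elements. *)
Lemma lift_perm_max_bij :
  bijective (fun ps : 'I_n.+1 * 'S_n => lift_perm ps.1 ord_max ps.2).
Proof.
apply: inj_card_bij => [[p s] [p' s'] /= eq_ps|].
  have eq_p : p = p'.
    by apply: (@perm_inj _ (lift_perm p ord_max s)); rewrite {2}eq_ps !lift_perm_id.
  rewrite -{}eq_p in eq_ps *; congr (_, _); apply/permP => i.
  by apply: val_inj; rewrite /= -!(val_lift_perm_max p) eq_ps.
by rewrite card_prod card_ord !card_Sn.
Qed.

End Descents.

Section InsertionSum.

Variables (R : comNzRingType) (x y : R).

(* The factor by which an insertion at slot [p < n] changes the weight; the last
   slot contributes the [1] added in [sum_slot_weight]. *)
Definition slot_weight (n : nat) (D : pred nat) (p : nat) : R :=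
  (if D p then y else x * y ^+ p.+1) * \prod_(i < n | D i && (p < i)%N) y.

(** Induction on [n]: if [n] is in [D], it lies beyond every earlier slot and multiplies all their
    weights by [y]; slot [n] itself has nothing beyond it. *)
Lemma sum_slot_weight (n : nat) (D : pred nat) :
  (1 - y) * (1 + \sum_(p < n) slot_weight n D p) =
  1 - x * y ^+ n.+1 - y * (1 - x) * \prod_(i < n | D i) y.
Proof.
elim: n => [|n IHn]; first by rewrite !big_ord0; ring.
have slotS (p : 'I_n) :
    slot_weight n.+1 D p = slot_weight n D p * (if D n then y else 1).
  by rewrite /slot_weight big_mkcond big_ord_recr -big_mkcond /= ltn_ord andbT mulrA.
have slot_last : slot_weight n.+1 D n = if D n then y else x * y ^+ n.+1.
  by rewrite /slot_weight big_pred0 ?mulr1 // => i; have := ltn_ord i; lia.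
rewrite big_ord_recr /= slot_last (eq_bigr _ (fun p _ => slotS p)) -mulr_suml.
rewrite [in RHS]big_mkcond big_ord_recr -big_mkcond /=.
move: IHn; move: (\sum_(i < n) _) (\prod_(i < n | _) _) => S P IHn.
have {}IHn : (1 - y) * S = y - x * y ^+ n.+1 - y * (1 - x) * P.
  by apply: (addrI (1 - y)); rewrite -[X in X + _]mulr1 -mulrDr IHn; ring.
case: (D n); rewrite !mulrDr ?mulr1 ?(mulrA (1 - y) S) IHn !exprS; ring.
Qed.

Definition perm_weight {d} (t : 'S_d) : R := x ^+ des t * y ^+ maj t.

Lemma perm_weightE {d} (t : 'S_d) :
  perm_weight t = \prod_(j in Des t) (x * y ^+ j).
Proof. by rewrite big_split /= prodr_const -expr_sum. Qed.

(** A predicate on naturals, because the induction in [sum_slot_weight] varies [n] with [D]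
    fixed. *)
Definition natDes {d} (t : 'S_d) : pred nat :=
  fun j => [exists i : 'I_d, (i == j :> nat) && (i \in Des t)].

Lemma natDesE {d} (t : 'S_d) (i : 'I_d) : natDes t i = (i \in Des t).
Proof.
apply/existsP/idP => [[k /andP[/eqP/val_inj-> //]]|Di].
by exists i; rewrite eqxx.
Qed.

(** Descents beyond the slot move one place right, each gaining a factor [y]. For [p < n] there is a
    descent at [p + 1]: either moved from [p] or new. *)
Lemma perm_weight_lift {n} (p : 'I_n.+1) (s : 'S_n) :
  perm_weight (lift_perm p ord_max s) =
  perm_weight s * (if (p < n)%N then slot_weight n (natDes s) p else 1).
Proof.
rewrite !perm_weightE [in LHS]big_mkcond (bigD1_ord p) //= mem_Des_slot mul1r.
under eq_bigr do rewrite mem_Des_lift.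
case: ltnP => [lt_pn|le_np]; last first.
  rewrite mulr1 [in RHS]big_mkcond; apply: eq_bigr => i _ /=.
  have lt_ip : (i < p)%N by apply: leq_trans (ltn_ord i) le_np.
  by rewrite ltn_eqF // orbF /bump leqNgt lt_ip.
pose k := Ordinal lt_pn.
(* The slot's own factor is written as a product concentrated at [i = k], so that the two sides can
   be compared factor by factor. *)
have slotE : (if natDes s p then y else x * y ^+ p.+1) =
    \prod_(i < n) if i == k then if i \in Des s then y else x * y ^+ i.+1 else 1.
  by rewrite -big_mkcond big_pred1_eq -natDesE.
rewrite [in RHS]big_mkcond /slot_weight slotE.
rewrite (big_mkcond (fun i : 'I_n => _ && _)) -!big_split /=.
apply: eq_bigr => i _; rewrite natDesE -val_eqE /bump /=.
by case: (i \in Des s); case: ltngtP => _ /=; rewrite ?exprS; ring.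
Qed.

Lemma sum_perm_weightS (n : nat) :
  (1 - y) * (\sum_(t : 'S_n.+1) perm_weight t) =
  \sum_(s : 'S_n) perm_weight s * (1 - x * y ^+ n.+1 - y * (1 - x) * y ^+ des s).
Proof.
rewrite (reindex _ (onW_bij _ (lift_perm_max_bij n))) /=.
rewrite -(pair_bigA _ (fun p s => perm_weight (lift_perm p ord_max s))) /=.
rewrite exchange_big mulr_sumr; apply: eq_bigr => s _ /=.
rewrite (eq_bigr _ (fun p _ => perm_weight_lift p s)) -mulr_sumr mulrCA.
congr (_ * _); rewrite big_ord_recr /= ltnn addrC.
under eq_bigr do rewrite ltn_ord.
rewrite sum_slot_weight; congr (_ - _ * _).
by under eq_bigl do rewrite natDesE; rewrite prodr_const.
Qed.

End InsertionSum.

Lemma subst2_EulerMahonian (n : nat) (a b : {poly {poly int}}) :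
  subst2 (EulerMahonian n) a b = \sum_(t : 'S_n) a ^+ des t * b ^+ maj t.
Proof.
(* Substitution is convertible to a composite of ring morphisms, hence commutes with sums and
   powers. *)
pose f : {rmorphism {poly {poly int}} -> {poly {poly int}}} := horner_eval b \o
  map_poly (horner_eval a \o map_poly (intr : int -> {poly {poly int}})).
have fE P : subst2 P a b = f P by [].
rewrite fE rmorph_sum; apply: eq_bigr => t _.
by rewrite rmorphM !rmorphXn -!fE subst2_q0 subst2_w.
Qed.

(** Replacing [q0] by [q0 * w] multiplies the weight of [s] by [w ^+ des s], the factor appearing in
    [sum_perm_weightS]. *)
Lemma EulerMahonian_rec (n : nat) :
  (1 - w) * EulerMahonian n.+1 =
  (1 - q0 * w ^+ n.+1) * EulerMahonian n
    - w * (1 - q0) * subst2 (EulerMahonian n) (q0 * w) w.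
Proof.
rewrite subst2_EulerMahonian (sum_perm_weightS _ q0 w) !mulr_sumr -sumrB.
by apply: eq_bigr => s _; rewrite /perm_weight exprMn; ring.
Qed.

Lemma EulerMahonian1 : EulerMahonian 1 = 1.
Proof.
have Des0 (t : 'S_1) : Des t = set0.
  by apply/setP => j; rewrite mem_Des0 ?inE // ord1.
rewrite /EulerMahonian (eq_bigr (fun=> 1)) => [|t _].
  by rewrite sumr_const card_Sn.
by rewrite /des /maj Des0 cards0 big_set0 mulr1.
Qed.

Theorem theorem1p1 (d : nat) (hd : (1 <= d)%N) :
  F d = EulerMahonian d.
Proof.
(* The induction starts at degree 1, since [F 0] is a dummy value. *)
case: d hd => // d _; elim: d => [|d IHd]; first by rewrite EulerMahonian1.
have w1_neq0 : 1 - w != 0 by rewrite -opprB oppr_eq0 polyXsubC_eq0.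
by apply: (mulfI w1_neq0); rewrite F_rec // EulerMahonian_rec /= -IHd.
Qed.
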